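(* Let $k$ be an odd positive integer, let $1\leq\ell_1\leq\ell_2\leq\ell_3\leq\ell_4$ be integers and $n=\ell_1+\ell_2+\ell_3+\ell_4$. If $n\geq7$, then the spider graph $S_{\ell_1,\ell_2,\ell_3,\ell_4}$ can be embedded in $K_k^*$ if and only if either (a) $\ell_3=1$ and $n\leq\binom{k+1}{2}-1$, or (b) $\ell_3\geq2$ and $n\leq\binom{k+1}{2}$.
   Context: $K_k^*$ denotes the complete graph $K_k$ on vertices $v_0,\dotsc,v_{k-1}$ with a loop $v_iv_i$ added at every vertex. An embedding of a graph $G$ in $K_k^*$ is a map $f:V(G)\to V(K_k^* )$ such that each edge $uv$ of $G$ is sent to the edge $f(u)f(v)$ of $K_k^*$ (a loop if $f(u)=f(v)$), and the induced map $E(G)\to E(K_k^* )$ is injective. The spider graph $S_{\ell_1,\dotsc,\ell_\Delta}$ ($\ell_1\leq\dotsb\leq\ell_\Delta$ positive integers) is the tree with central vertex $x_0$ and, for each $i$, a path $x_0x^i_1x^i_2\dotsb x^i_{\ell_i}$ (the $i$-th leg, with $\ell_i$ edges), the legs sharing only $x_0$. *)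

(* Defs.v *)
From mathcomp Require Import all_boot.

Set Implicit Arguments.
Unset Strict Implicit.
Unset Printing Implicit Defensive.

(* Finite undirected graphs without multiple edges; loops are allowed
   ([adj] need not be irreflexive). *)
Record graph := Graph {
  vertex : finType;
  adj : rel vertex;
  adj_sym : symmetric adj
}.

(* The edge uv is the set [set u; v], so that a loop is a singleton. *)
Definition edges (G : graph) : {set {set vertex G}} :=
  [set [set p.1; p.2] | p : vertex G * vertex G & adj p.1 p.2].

(* On an edge, [f @: [set u; v] = [set f u; f v]] is the induced edge map.
   [f] itself need not be injective on vertices. *)
Definition is_embedding (G H : graph) (f : vertex G -> vertex H) : Prop :=
  (forall u v : vertex G, adj u v -> adj (f u) (f v)) /\
  {in edges G &, injective (fun e : {set vertex G} => f @: e)}.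

Definition embeddable (G H : graph) : Prop :=
  exists f : vertex G -> vertex H, is_embedding f.

Definition looped_complete_adj (k : nat) : rel 'I_k := fun _ _ => true.

Lemma looped_complete_adj_sym (k : nat) : symmetric (@looped_complete_adj k).
Proof. by []. Qed.

Definition looped_complete (k : nat) : graph :=
  Graph (@looped_complete_adj_sym k).

(* [None] is the central vertex x_0, and [Some (Tagged _ j)] with tag i is
   the vertex x^i_(j+1): legs and positions on a leg are numbered from 0. *)
Definition spider_vertex (d : nat) (l : d.-tuple nat) : finType :=
  option {i : 'I_d & 'I_(tnth l i)}.

Definition spider_succ (d : nat) (l : d.-tuple nat) : rel (spider_vertex l) :=
  fun x y =>
    match x, y with
    | None, Some v => tagged v == 0 :> nat
    | Some u, Some v =>
        (tag u == tag v) && (tagged v == (tagged u).+1 :> nat)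
    | _, None => false
    end.

Definition spider_adj (d : nat) (l : d.-tuple nat) : rel (spider_vertex l) :=
  fun x y => spider_succ x y || spider_succ y x.

Lemma spider_adj_sym (d : nat) (l : d.-tuple nat) : symmetric (@spider_adj d l).
Proof. by move=> x y; rewrite /spider_adj orbC. Qed.

Definition spider (d : nat) (l : d.-tuple nat) : graph :=
  Graph (@spider_adj_sym d l).

(* Main.v *)
Require Import Defs.
From mathcomp Require Import all_boot zify.

(* All vertices of K_k^* have even degree when k is odd, so K_k^* has an
   Eulerian circuit.  For k >= 5 it can be chosen to return to its starting
   point x_0 after exactly a steps, for any 3 <= a <= C(k+1, 2) / 2; the four
   ways of leaving x_0 along this circuit (forwards and backwards on each of the
   two closed halves) then accommodate the legs, with a = l1 + l3, or a = 3 if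
   l3 = 1.  Such circuits are built by induction from k to k + 2: the new edges
   at the two new vertices p, q split into the 4-cycles p, 2j+1, q, 2j+2 and a
   closed trail through 0, and a is adjusted by choosing how many of the 4-cycles
   go to the first half.
   Conversely, if l1 = l2 = l3 = 1 and all edges are used, each vertex is the end
   of an even number of legs; but the three short legs have distinct ends, which
   would all have to be paired with the end of the fourth leg. *)

Set Implicit Arguments.
Unset Strict Implicit.
Unset Printing Implicit Defensive.

(** * Undirected edges of the looped complete graph, as sorted pairs *)

Definition uedge (u v : nat) : nat * nat := (minn u v, maxn u v).

Lemma uedgeC u v : uedge u v = uedge v u.
Proof. by rewrite /uedge minnC maxnC. Qed.

Lemma uedge_leq u v : u <= v -> uedge u v = (u, v).
Proof. by move=> le_uv; rewrite /uedge; congr (_, _); lia. Qed.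

Lemma uedge_eq u v u' v' :
  uedge u v = uedge u' v' -> u = u' /\ v = v' \/ u = v' /\ v = u'.
Proof.
rewrite /uedge; case: (leqP u v) => _; case: (leqP u' v') => _ [-> ->];
  by [left | right].
Qed.

Definition complete_edges (k : nat) : seq (nat * nat) :=
  [seq (i, j) | j <- iota 0 k, i <- iota 0 j.+1].

Lemma mem_complete_edges k e : (e \in complete_edges k) = (e.1 <= e.2 < k).
Proof.
apply/allpairsPdep/idP => [[j [i [jk ij ->]]]|].
  by move: jk ij; rewrite !mem_iota !add0n /= ltnS => -> ->.
case: e => i j /= /andP[ij jk]; exists j, i.
by rewrite (mem_iota 0 j.+1) mem_iota.
Qed.

Lemma size_complete_edges k : size (complete_edges k) = 'C(k.+1, 2).
Proof.
rewrite -bin2_sum big_nat_recl // add0n size_allpairs_dep sumnE big_map.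
by rewrite /index_iota subn0; apply: eq_bigr => i _; rewrite size_iota.
Qed.

Lemma complete_edges_uniq k : uniq (complete_edges k).
Proof.
apply: allpairs_uniq_dep => [|j _|[j i] [j' i'] _ _ /=]; rewrite ?iota_uniq //.
by case=> -> ->.
Qed.

Lemma uedge_complete k u v : u < k -> v < k -> uedge u v \in complete_edges k.
Proof. by rewrite mem_complete_edges /=; lia. Qed.

(** * Eulerian circuits with a prescribed intermediate return *)

Lemma bin2_step2 k : 'C(k.+3, 2) = 'C(k.+1, 2) + k.*2.+3.
Proof. by rewrite binS bin1 binS bin1; lia. Qed.

(* Concatenated 4-cycles p, 2j+1, q, 2j+2, p; the starting point p is omitted. *)
Definition squares (p q i n : nat) : seq nat :=
  flatten [seq [:: j.*2.+1; q; j.*2.+2; p] | j <- iota i n].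

Lemma squares_rec p q i n :
  squares p q i n.+1 = [:: i.*2.+1, q, i.*2.+2, p & squares p q i.+1 n].
Proof. by []. Qed.

Lemma size_squares p q i n : size (squares p q i n) = 4 * n.
Proof. by elim: n i => [|n IHn] i; rewrite ?muln0 // squares_rec /= IHn; lia. Qed.

Lemma last_squares p q i n : last p (squares p q i n) = p.
Proof. by elim: n i => // n IHn i; rewrite squares_rec /= IHn. Qed.

Lemma squares_bound k p q i n :
  p < k -> q < k -> (i + n).*2 < k -> all (gtn k) (squares p q i n).
Proof.
move=> pk qk; elim: n i => // n IHn i ink.
by rewrite squares_rec /= IHn; lia.
Qed.

Lemma squares_cover p q i n v : i.*2 < v <= (i + n).*2 ->
  uedge v p \in pairmap uedge p (squares p q i n)
  /\ uedge v q \in pairmap uedge p (squares p q i n).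
Proof.
elim: n i => [|n IHn] i vin; first by lia.
rewrite squares_rec /= !inE.
have [lt_v|] := ltnP i.+1.*2 v.
  by have [|-> ->] := IHn i.+1; rewrite ?orbT //; lia.
move=> v_le; have /orP[/eqP->|/eqP->] : (v == i.*2.+1) || (v == i.*2.+2) by lia.
  by rewrite (uedgeC p) !eqxx ?orbT.
by rewrite (uedgeC q) !eqxx ?orbT.
Qed.

(* 0, 1, s, t is an Eulerian circuit returning to 0 after [a] edges. Its second
   vertex is fixed so that new 4-cycles can be attached to the first half at 1,
   the new edges at 0 being needed by the second half. *)
Definition split_circuit (k a : nat) (s t : seq nat) : Prop :=
  [/\ size s = a.-1, size s + size t + 1 = 'C(k.+1, 2),
      last 1 s = 0 /\ last 0 t = 0, all (gtn k) (s ++ t)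
    & {subset complete_edges k <= pairmap uedge 0 (1 :: s ++ t)}].

(** Base case of the induction; 7 is the largest [a] with [a.*2 <= 15]. The explicit circuits are
    checked by computation. *)
Lemma split_circuit5 a : 3 <= a <= 7 -> exists s t, split_circuit 5 a s t.
Proof.
case: a => [|[|[|[|[|[|[|[|//]]]]]]]] //= _.
- exists [:: 2; 0], [:: 0; 3; 1; 1; 4; 2; 2; 3; 3; 4; 4; 0].
  by split=> //; apply/allP.
- exists [:: 1; 2; 0], [:: 0; 3; 1; 4; 2; 2; 3; 3; 4; 4; 0].
  by split=> //; apply/allP.
- exists [:: 1; 2; 0; 0], [:: 3; 1; 4; 2; 2; 3; 3; 4; 4; 0].
  by split=> //; apply/allP.
- exists [:: 1; 2; 2; 0; 0], [:: 3; 1; 4; 2; 3; 3; 4; 4; 0].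
  by split=> //; apply/allP.
- exists [:: 1; 2; 2; 3; 0; 0], [:: 2; 4; 1; 3; 3; 4; 4; 0].
  by split=> //; apply/allP.
Qed.

(** A closed detour [sA] at 1 lengthens the first half by [r] of the [m] new 4-cycles. A closed
    detour [tB] at 0 appends to the second half the other 4-cycles and the five edges 0p, pp, pq,
    qq, q0. *)
Lemma split_circuit_step m a r s t (k := m.*2.+1) :
    r <= m -> 0 < a -> split_circuit k a s t ->
  exists s' t', split_circuit k.+2 (a + 4 * r) s' t'.
Proof.
move=> rm a_gt0 [sz_s sz_t [last_s last_t] st_k cover].
pose p := k; pose q := k.+1.
(* The 4-cycle 1, p, 2, q is entered from 1; the other [r'] cycles are run through at [p] before it
   closes via 2 and [q]. *)
pose sA := if r is r'.+1 then p :: squares p q 1 r' ++ [:: 2; q; 1] else [::].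
pose tB := [:: p, p & squares p q r (m - r) ++ [:: q; q; 0]].
have last_sA : last 1 sA = 1.
  by rewrite /sA; case: (r) => //= r'; rewrite last_cat.
have sz_sA : size sA = 4 * r.
  by rewrite /sA; case: (r) => //= r'; rewrite size_cat size_squares /=; lia.
have sz_tB : size tB = 4 * (m - r) + 5.
  by rewrite /= size_cat size_squares /=; lia.
exists (sA ++ s), (t ++ tB); split.
- by rewrite size_cat; lia.
- by rewrite !size_cat bin2_step2; lia.
- by rewrite !last_cat last_sA last_s last_t /= last_cat.
- have st_k2 : all (gtn k.+2) (s ++ t) by apply: sub_all st_k => x /=; lia.
  move: st_k2; rewrite !all_cat => /andP[-> ->]; rewrite andbT /=.
  rewrite all_cat squares_bound /=; try by rewrite /p /q /k; lia.
  rewrite /sA; case: (r) rm => [|r'] rm /=; first by rewrite /p /q; lia.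
  rewrite all_cat squares_bound /=; rewrite /p /q /k; lia.
have edges_eq : pairmap uedge 0 (1 :: (sA ++ s) ++ t ++ tB)
    =i pairmap uedge 0 (1 :: s ++ t) ++ pairmap uedge 1 sA ++ pairmap uedge 0 tB.
  move: (tB) => tB' e; rewrite /= !pairmap_cat !last_cat !last_sA !last_s last_t.
  rewrite !(inE, mem_cat) -!orbA; congr orb.
  by case: (e \in pairmap _ _ sA); rewrite ?orbT.
have coverA v : 0 < v <= r.*2 ->
    uedge v p \in pairmap uedge 1 sA /\ uedge v q \in pairmap uedge 1 sA.
  rewrite /sA; case: (r) => [|r'] vr /=; first by lia.
  rewrite pairmap_cat last_squares /= !(inE, mem_cat).
  have [v_gt2|] := ltnP 2 v.
    by have [|-> ->] := @squares_cover p q 1 r' v; rewrite ?orbT //; lia.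
  move=> v_le; have /orP[/eqP->|/eqP->] : (v == 1) || (v == 2) by lia.
    by rewrite (uedgeC q) !eqxx ?orbT.
  by rewrite (uedgeC p) !eqxx ?orbT.
have coverB v : r.*2 < v < k ->
    uedge v p \in pairmap uedge 0 tB /\ uedge v q \in pairmap uedge 0 tB.
  move=> vr; rewrite /tB /= pairmap_cat !(inE, mem_cat).
  by have [|-> ->] := @squares_cover p q r (m - r) v; rewrite ?orbT // /k; lia.
have [c0p c0q cpp cpq cqq] :
    [/\ uedge 0 p \in pairmap uedge 0 tB, uedge 0 q \in pairmap uedge 0 tB,
        uedge p p \in pairmap uedge 0 tB, uedge p q \in pairmap uedge 0 tB
      & uedge q q \in pairmap uedge 0 tB].
  rewrite /tB /= pairmap_cat last_squares /= (uedgeC q 0).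
  by rewrite !(inE, mem_cat) !eqxx ?orbT.
case=> i j; rewrite mem_complete_edges => /=.
move: (i : nat) (j : nat) => {}i {}j /andP[ij jk2].
rewrite edges_eq 2!mem_cat; have [jk|kj] := ltnP j k.
  by rewrite cover // mem_complete_edges /= ij.
rewrite -(uedge_leq ij).
have [ik|ki] := ltnP i k.
  have /orP[/eqP->|/eqP->] : (j == p) || (j == q) by rewrite /p /q; lia.
    case: (posnP i) => [->|i_gt0]; first by rewrite c0p ?orbT.
    have [ir|ri] := leqP i r.*2.
      by have [|-> _] := coverA i; rewrite ?orbT //; lia.
    by have [|-> _] := coverB i; rewrite ?orbT //; lia.
  case: (posnP i) => [->|i_gt0]; first by rewrite c0q ?orbT.
  have [ir|ri] := leqP i r.*2.
    by have [|_ ->] := coverA i; rewrite ?orbT //; lia.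
  by have [|_ ->] := coverB i; rewrite ?orbT //; lia.
have /or3P[] : [|| (i == p) && (j == p), (i == p) && (j == q)
                 | (i == q) && (j == q)] by rewrite /p /q; lia.
- by case/andP=> /eqP-> /eqP->; rewrite cpp ?orbT.
- by case/andP=> /eqP-> /eqP->; rewrite cpq ?orbT.
- by case/andP=> /eqP-> /eqP->; rewrite cqq ?orbT.
Qed.

Lemma split_circuit_exists m a (k := m.*2.+1) :
    2 <= m -> 3 <= a -> a.*2 <= 'C(k.+1, 2) ->
  exists s t, split_circuit k a s t.
Proof.
rewrite {}/k; elim: m a => // m IHm a; rewrite ltnS leq_eqVlt.
case/predU1P=> [<-|m_gt1] a_ge3.
  rewrite (_ : 'C(_, 2) = 15) // => a_le.
  by apply: split_circuit5; lia.
rewrite doubleS bin2_step2 => a_le.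
have C15 : 15 <= 'C(m.*2.+2, 2).
  by apply: (@leq_trans 'C(6, 2)) => //; apply: leq_bin2l; lia.
(* If the minimum is the quotient, then [a - 4 * r] is at most 6, and 12 is below 15. If it is [m],
   then [a.*2] drops by 8m, while the number of edges drops by 4m + 5 only, which is no more since
   [m >= 2]. *)
pose r := minn m ((a - 3) %/ 4).
have [||s [t st]] := IHm (a - 4 * r) m_gt1; [by lia | by lia |].
have -> : a = a - 4 * r + 4 * r by lia.
by apply: split_circuit_step st; lia.
Qed.

(** A list of 'C(k+1, 2) edges that covers all the edges cannot repeat one, so covering and length
    yield injectivity. *)
Lemma eulerian_circuit k a : odd k -> 5 <= k -> 3 <= a -> a.*2 <= 'C(k.+1, 2) ->
  exists w : nat -> nat,
    [/\ forall j, w j < k, w a = w 0, w 'C(k.+1, 2) = w 0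
      & {in gtn 'C(k.+1, 2) &, injective (fun j => uedge (w j) (w j.+1))}].
Proof.
move=> k_odd k_ge5 a_ge3 a_le; set C := 'C(_, 2) in a_le *.
have k_eq : k = k./2.*2.+1 by rewrite -[LHS]odd_double_half k_odd.
have [||| s [t []]] := @split_circuit_exists k./2 a; rewrite -?k_eq //; first by lia.
rewrite -/C => sz_s sz_t [last_s last_t] st_k cover.
pose W := 1 :: s ++ t; have sz_W : size W = C by rewrite /= size_cat; lia.
have nth_last0 : nth 0 (0 :: W) C = 0.
  by rewrite -sz_W (nth_last 0 (0 :: W)) /= last_cat last_s.
exists (nth 0 (0 :: W)); split=> //.
- move=> j; have W_k : all (gtn k) (0 :: W) by rewrite /= st_k; lia.
  have [jW|Wj] := ltnP j (size (0 :: W)); first exact: (allP W_k _ (mem_nth 0 jW)).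
  by rewrite nth_default //; lia.
- have -> : a = (size s).+1 by lia.
  change (nth 0 ((1 :: s) ++ t) (size s) = 0); rewrite nth_cat ltnSn.
  by rewrite (nth_last 0 (1 :: s)).
have W_uniq : uniq (pairmap uedge 0 W).
  apply: leq_size_uniq cover _; first exact: complete_edges_uniq.
  by rewrite size_pairmap sz_W size_complete_edges.
move=> i j iC jC /=; have sz_p : size (pairmap uedge 0 W) = C by rewrite size_pairmap.
rewrite -!(@nth_pairmap _ 0 _ (0, 0)) ?sz_W // => /eqP.
by rewrite nth_uniq ?sz_p // => /eqP.
Qed.

(** * Spider embeddings as families of walks *)

Lemma set2_uedge k (a b c d : 'I_k) :
  [set a; b] = [set c; d] <-> uedge a b = uedge c d.
Proof.
split=> [eq_ab|/uedge_eq[] [/val_inj-> /val_inj->] //]; last by rewrite setUC.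
have /set2P a_cd : a \in [set c; d] by rewrite -eq_ab set21.
have /set2P b_cd : b \in [set c; d] by rewrite -eq_ab set22.
have /set2P c_ab : c \in [set a; b] by rewrite eq_ab set21.
have /set2P d_ab : d \in [set a; b] by rewrite eq_ab set22.
case: a_cd b_cd c_ab d_ab => -> [->|->] // c_ab d_ab.
- by case: d_ab => ->.
- exact: uedgeC.
- by case: c_ab => ->.
Qed.

Section SpiderWalks.

Variables (d : nat) (l : d.+1.-tuple nat).
Implicit Types (i : 'I_d.+1) (j : nat).

(* The j-th vertex on leg i, counting the centre as number 0; it has the junk
   value [None] when [j > tnth l i]. *)
Definition leg_vertex i j : spider_vertex l :=
  if j is j'.+1 then
    omap (Tagged (fun i => 'I_(tnth l i))) (insub j' : option 'I_(tnth l i))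
  else None.

Definition depth (x : spider_vertex l) : nat :=
  if x is Some v then (tagged v).+1 else 0.

Lemma leg_vertexS i (j : 'I_(tnth l i)) :
  leg_vertex i j.+1 = Some (Tagged (fun i => 'I_(tnth l i)) j).
Proof. by rewrite /= valK. Qed.

Lemma depth_leg_vertex i j : j <= tnth l i -> depth (leg_vertex i j) = j.
Proof. by case: j => //= j lt_j; rewrite insubT. Qed.

Arguments leg_vertex : simpl never.

Lemma spider_succP (x y : spider_vertex l) :
  reflect (exists i (j : 'I_(tnth l i)), x = leg_vertex i j /\ y = leg_vertex i j.+1)
          (spider_succ x y).
Proof.
apply: (iffP idP) => [|[i [[j lt_j] [-> ->]]]].
  case: y => [[i j]|]; last by case: x.
  case: x => [[i' j']|]; rewrite /spider_succ; last first.
    by move=> eq_j; exists i, j; rewrite leg_vertexS (eqP eq_j).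
  move=> /andP[/eqP/= eq_i]; case: _ / eq_i j => j /eqP/= eq_j.
  by exists i', j; rewrite leg_vertexS eq_j leg_vertexS.
rewrite leg_vertexS; case: j lt_j => //= j lt_j.
by rewrite /leg_vertex insubT ?(ltnW lt_j) //= => lt_j'; rewrite !eqxx.
Qed.

Lemma edges_spiderP (e : {set vertex (spider l)}) :
  reflect (exists i (j : 'I_(tnth l i)), e = [set leg_vertex i j; leg_vertex i j.+1])
          (e \in edges (spider l)).
Proof.
apply: (iffP imsetP) => [[[x y]]|[i [j ->]]].
  rewrite inE /= => /orP[] /spider_succP[i [j [-> ->]]] ->; exists i, j => //.
  exact: setUC.
exists (leg_vertex i j, leg_vertex i j.+1) => //; rewrite inE.
by apply/orP; left; apply/spider_succP; exists i, j.
Qed.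

(** An edge is determined by its end farther from the centre; matching the far end of each edge with
    the near end of the other would contradict the depths. *)
Lemma leg_edge_inj i i' (j : 'I_(tnth l i)) (j' : 'I_(tnth l i')) :
    [set leg_vertex i j; leg_vertex i j.+1]
      = [set leg_vertex i' j'; leg_vertex i' j'.+1] ->
  i = i' /\ j = j' :> nat.
Proof.
move=> eq_e; have jl := ltn_ord j; have jl' := ltn_ord j'.
have eq_last : leg_vertex i j.+1 = leg_vertex i' j'.+1.
  have /set2P[e1|//] : leg_vertex i j.+1 \in [set leg_vertex i' j'; leg_vertex i' j'.+1].
    by rewrite -eq_e set22.
  have /set2P[e2|//] : leg_vertex i' j'.+1 \in [set leg_vertex i j; leg_vertex i j.+1].
    by rewrite eq_e set22.
  move/(congr1 depth): e1; move/(congr1 depth): e2.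
  by rewrite !depth_leg_vertex; lia.
split; first by move: eq_last; rewrite !leg_vertexS => /(congr1 (omap tag)) [].
by move/(congr1 depth): eq_last; rewrite !depth_leg_vertex //; case.
Qed.

(** Adjacency is automatic in the target, so only a common start and the distinctness of all edges,
    within and across legs, remain. *)
Lemma embeddable_spiderP k :
  embeddable (spider l) (looped_complete k) <->
  exists w : 'I_d.+1 -> nat -> nat,
    [/\ forall i j, w i j < k, forall i i', w i 0 = w i' 0
      & forall i i' j j', j < tnth l i -> j' < tnth l i' ->
          uedge (w i j) (w i j.+1) = uedge (w i' j') (w i' j'.+1) ->
        i = i' /\ j = j'].
Proof.
split=> [[f [_ f_inj]]|[w [w_k w0 w_inj]]].
  (* Past the end of a leg the walk takes the value [f None], so it stays below [k] for every
     [j]. *)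
  exists (fun i j => f (leg_vertex i j) : 'I_k); split=> // i i' j j' jl jl' eq_f.
  have in_edges i0 j0 (jl0 : j0 < tnth l i0) :
      [set leg_vertex i0 j0; leg_vertex i0 j0.+1] \in edges (spider l).
    by apply/edges_spiderP; exists i0, (Ordinal jl0).
  have := f_inj _ _ (in_edges _ _ jl) (in_edges _ _ jl').
  rewrite !imsetU !imset_set1 => /(_ ((set2_uedge _ _ _ _).2 eq_f)).
  exact: (@leg_edge_inj _ _ (Ordinal jl) (Ordinal jl')).
pose f (x : spider_vertex l) : 'I_k :=
  if x is Some v then Ordinal (w_k (tag v) (tagged v).+1) else Ordinal (w_k ord0 0).
have fE i j : j <= tnth l i -> f (leg_vertex i j) = w i j :> nat.
  by case: j => [|j] jl; rewrite /leg_vertex ?insubT //; apply: w0.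
exists f; split=> // e e' /edges_spiderP[i [j ->]] /edges_spiderP[i' [j' ->]].
rewrite !imsetU !imset_set1 => /set2_uedge; rewrite !fE //; try exact: ltnW.
move/w_inj=> []; rewrite ?ltn_ord // => eq_i.
by case: _ / eq_i j' => j' /val_inj->.
Qed.

End SpiderWalks.

(** * Counting edges and parity of degrees *)

(** A loop counts twice, which makes every degree [k.+1]. *)
Definition edge_inc (v : nat) (e : nat * nat) : nat := (e.1 == v) + (e.2 == v).

Lemma edge_inc_uedge v a b : edge_inc v (uedge a b) = (a == v) + (b == v).
Proof. by rewrite /edge_inc /uedge; case: (leqP a b) => //= _; rewrite addnC. Qed.

Lemma complete_degree k v :
  v < k -> \sum_(e <- complete_edges k) edge_inc v e = k.+1.
Proof.
have iotaE n : iota 0 n = index_iota 0 n by rewrite /index_iota subn0.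
have sum_eq n : \sum_(0 <= i < n) (i == v) = (v < n).
  elim: n => [|n IHn]; first by rewrite big_geq.
  by rewrite big_nat_recr //= IHn; lia.
rewrite big_allpairs_dep /edge_inc iotaE => vk.
(* The value 0 for [v >= k] lets the induction on [k] pass the stage where [v] is added. *)
suff -> : \sum_(0 <= j < k) \sum_(i <- iota 0 j.+1) ((i == v) + (j == v))
    = if v < k then k.+1 else 0 by rewrite vk.
elim: k {vk} => [|k IHk]; first by rewrite big_geq.
rewrite big_nat_recr // IHk iotaE big_split sum_eq sum_nat_const_nat /=.
by rewrite ltnS; case: (ltngtP v k) => _ /=; lia.
Qed.

(** Each intermediate visit to [v] is counted twice, so only the two ends matter modulo 2. *)
Lemma odd_walk (w : nat -> nat) v n :
  odd (\sum_(j < n) ((w j == v) + (w j.+1 == v))) = (w 0 == v) (+) (w n == v).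
Proof.
elim: n => [|n IHn]; first by rewrite big_ord0 addbb.
rewrite big_ord_recr oddD IHn oddD !oddb addbA.
by rewrite -[_ (+) _ (+) (w n == v)]addbA addbb addbF.
Qed.

Section WalkCount.

Variables (d k : nat) (l : 'I_d -> nat) (w : 'I_d -> nat -> nat).
Hypothesis w_lt : forall i j, w i j < k.
Hypothesis w_inj : forall i i' j j', j < l i -> j' < l i' ->
  uedge (w i j) (w i j.+1) = uedge (w i' j') (w i' j'.+1) -> i = i' /\ j = j'.

Let walk_edges :=
  [seq uedge (w i j) (w i j.+1) | i <- enum 'I_d, j <- iota 0 (l i)].

Lemma size_walk_edges : size walk_edges = \sum_i l i.
Proof.
rewrite size_allpairs_dep sumnE big_map big_enum.
by apply: eq_bigr => i _; rewrite size_iota.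
Qed.

Lemma walk_edges_uniq : uniq walk_edges.
Proof.
apply: allpairs_uniq_dep => [|i _|]; rewrite ?enum_uniq ?iota_uniq //.
move=> _ _ /allpairsPdep[i [j [_ ji ->]]] /allpairsPdep[i' [j' [_ ji' ->]]] /=.
by move: ji ji'; rewrite !mem_iota !add0n => ji ji' /w_inj[] // -> ->.
Qed.

Lemma walk_edges_sub : {subset walk_edges <= complete_edges k}.
Proof. by move=> _ /allpairsPdep[i [j [_ _ ->]]]; apply: uedge_complete. Qed.

Lemma walks_size_le : \sum_i l i <= 'C(k.+1, 2).
Proof.
rewrite -size_walk_edges -size_complete_edges.
exact: uniq_leq_size walk_edges_uniq walk_edges_sub.
Qed.

(* Walks covering all edges have an even number of ends at each vertex,
   because all degrees are even when k is odd. *)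
Lemma walks_ends_even v : odd k -> v < k -> \sum_i l i = 'C(k.+1, 2) ->
  \big[addb/false]_i ((w i 0 == v) (+) (w i (l i) == v)) = false.
Proof.
move=> k_odd vk cover.
(* Distinct edges, as many as the graph has, are all its edges. *)
have perm_w : perm_eq walk_edges (complete_edges k).
  apply: uniq_perm; rewrite ?walk_edges_uniq ?complete_edges_uniq //.
  have sz : size (complete_edges k) <= size walk_edges.
    by rewrite size_complete_edges size_walk_edges cover.
  by have [] := uniq_min_size walk_edges_uniq walk_edges_sub sz.
have := congr1 odd (complete_degree vk).
rewrite -(perm_big _ perm_w) big_allpairs_dep big_enum (big_morph odd oddD (erefl _)) /=.
rewrite k_odd => parity; rewrite -[RHS]parity; apply: eq_bigr => i _.
have -> : iota 0 (l i) = index_iota 0 (l i) by rewrite /index_iota subn0.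
rewrite -odd_walk big_mkord; congr odd.
by apply: eq_bigr => j _; rewrite edge_inc_uedge.
Qed.

End WalkCount.

(** * Necessity by parity, sufficiency by cutting a circuit into legs *)

Theorem theorem2p10 (k l1 l2 l3 l4 : nat) (k_odd : odd k)
    (l1_gt0 : 1 <= l1) (l12 : l1 <= l2) (l23 : l2 <= l3) (l34 : l3 <= l4)
    (n_ge7 : 7 <= l1 + l2 + l3 + l4) :
  embeddable (spider [tuple l1; l2; l3; l4]) (looped_complete k) <->
  (l3 = 1 /\ l1 + l2 + l3 + l4 <= 'C(k.+1, 2) - 1) \/
  (2 <= l3 /\ l1 + l2 + l3 + l4 <= 'C(k.+1, 2)).
Proof.
rewrite embeddable_spiderP; set l := [tuple _; _; _; _].
have sum_l : \sum_i tnth l i = l1 + l2 + l3 + l4.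
  by rewrite !big_ord_recl big_ord0 !(tnth_nth 0) /= addn0 !addnA.
split=> [[w [w_k w0 w_inj]]|l_le].
  have := walks_size_le w_k w_inj; rewrite sum_l => le_C.
  have [l3_gt1|l3_le1] := ltnP 1 l3; [by right | left].
  have [l1_1 l2_1 l3_1] : [/\ l1 = 1, l2 = 1 & l3 = 1] by split; lia.
  split=> //; suff : l1 + l2 + l3 + l4 <> 'C(k.+1, 2) by lia.
  rewrite -sum_l => cover.
  pose leg i : 'I_4 := inord i; pose y i := w (leg i) 1.
  have tl i : i < 3 -> tnth l (leg i) = 1.
    rewrite (tnth_nth 0) /leg => i3; rewrite inordK ?(leqW i3) //.
    by case: i i3 => [|[|[|]]].
  (* The four legs share their start, whose contributions cancel in pairs. *)
  have ends v : v < k ->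
      (y 0 == v) (+) (y 1 == v) (+) (y 2 == v) = (w (leg 3) l4 == v).
    have tl3 : tnth l (leg 3) = l4 by rewrite (tnth_nth 0) /leg inordK.
    move=> /(walks_ends_even w_k w_inj k_odd)/(_ cover).
    have sum4 (F : 'I_4 -> bool) : \big[addb/false]_i F i =
        F (leg 0) (+) (F (leg 1) (+) (F (leg 2) (+) F (leg 3))).
      rewrite !big_ord_recl big_ord0 addbF.
      by do ![congr (_ (+) _)]; congr F; apply: val_inj; rewrite /= inordK.
    rewrite sum4 tl3 !tl // !(w0 _ ord0) -!/(y _).
    by do 5?case: (_ == v).
  (* Two short legs with the same end would use the same edge. *)
  have y_neq i j : i < j < 3 -> (y i == y j) = false.
    move=> ij; apply/eqP => eq_y.
    have [] := @w_inj (leg i) (leg j) 0 0; rewrite ?tl; try lia.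
      by rewrite (w0 (leg i) (leg j)) -/(y i) eq_y.
    by move=> /(congr1 val); rewrite /= !inordK; lia.
  (* Evaluated at [y 0] and then at [y 1], the parity relation puts the end of the long leg at both,
     though they differ. *)
  have /eqP e0 : w (leg 3) l4 == y 0.
    by rewrite -(ends _ (w_k _ _)) eqxx (eq_sym (y 1)) (eq_sym (y 2)) !y_neq.
  have := ends (y 1) (w_k _ _).
  by rewrite e0 eqxx (eq_sym (y 2)) !y_neq.
(* For odd [k < 5] there are at most 6 edges, fewer than [n]. *)
have k_ge5 : 5 <= k.
  rewrite leqNgt; apply/negP => k_lt5.
  have : 'C(k.+1, 2) <= 'C(4, 2).
    by apply: leq_bin2l; case: k k_odd k_lt5 {l_le} => [|[|[|[|[|]]]]].
  rewrite (_ : 'C(4, 2) = 6) //; lia.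
have C15 : 15 <= 'C(k.+1, 2).
  by apply: (@leq_trans 'C(6, 2)) => //; apply: leq_bin2l; lia.
(* The maximum exceeds [l1 + l3] only if [l3 = 1]; one edge of the first half is then left over,
   which the stricter bound on [n] allows. *)
pose a := maxn 3 (l1 + l3).
have [a_ge3 a_le l13a l24a] : [/\ 3 <= a, a.*2 <= 'C(k.+1, 2), l1 + l3 <= a
    & l2 + l4 + a <= 'C(k.+1, 2)] by split; rewrite /a; lia.
have [W [W_k Wa WC W_inj]] := eulerian_circuit k_odd k_ge5 a_ge3 a_le.
set C := 'C(_, 2) in WC W_inj a_le l24a.
(* Legs 1 and 3 enter the first half from its two ends, legs 2 and 4 the second half. *)
pose pos i j := nth 0 [:: j; a + j; a - j; C - j] i.
exists (fun i j => W (pos i j)); split=> //.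
  suff W0 (i : 'I_4) : W (pos i 0) = W 0 by move=> i i'; rewrite !W0.
  by case: i => [[|[|[|[|//]]]] ?]; rewrite /pos /= ?addn0 ?subn0.
(* Circuit edges are indexed by their earlier end, hence [j.+1] on the two legs that run backwards.
   The index ranges of the four legs are disjoint. *)
pose epos i j := nth 0 [:: j; a + j; a - j.+1; C - j.+1] i.
have edgeE (i : 'I_4) j : j < tnth l i ->
    uedge (W (pos i j)) (W (pos i j.+1)) = uedge (W (epos i j)) (W (epos i j).+1).
  case: i => [[|[|[|[|//]]]] ?]; rewrite (tnth_nth 0) /pos /epos //= => jl.
  - by rewrite addnS.
  - by rewrite uedgeC -subSn ?subSS //; lia.
  - by rewrite uedgeC -subSn ?subSS //; lia.
move=> i i' j j' jl jl'; rewrite !edgeE // => /W_inj.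
have epos_lt (i0 : 'I_4) j0 : j0 < tnth l i0 -> epos i0 j0 < C.
  by case: i0 => [[|[|[|[|//]]]] ?]; rewrite (tnth_nth 0) /epos /=; lia.
rewrite !inE !epos_lt // => /(_ isT isT) eq_pos.
suff : i = i' :> nat /\ j = j' by case=> /val_inj.
move: jl jl' eq_pos; rewrite !(tnth_nth 0) /epos.
by case: i i' => [[|[|[|[|//]]]] ?] [[|[|[|[|//]]]] ?] /=; lia.
Qed.
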